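(* For every fixed $\varepsilon>0$ and all sufficiently large $n$, there exists an $n$-vertex graph $G$ with $\alpha(G)\leq 2$ which does not contain an odd connected pairing of size at least $\varepsilon n$.
   Context: $\alpha(G)$ denotes the independence number. An odd connected pairing of size $s$ in a graph $G$ is a set $\{(u_1,v_1),\dots,(u_s,v_s)\}$ of $s$ ordered pairs, where $u_1,v_1,\dots,u_s,v_s\in V(G)$ are pairwise distinct, such that for all $i\neq j$ at least one of $\{u_i,u_j\}$, $\{v_i,v_j\}$ is an edge of $G$. *)

(* Defs.v *)
From mathcomp Require Import all_boot all_order all_algebra.
From mathcomp Require Import reals.
Set Implicit Arguments. Unset Strict Implicit. Unset Printing Implicit Defensive.
Import Order.TTheory GRing.Theory Num.Theory.

Definition simple_graph (T : finType) (e : rel T) : Prop :=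
  irreflexive e /\ symmetric e.

Definition independent (T : finType) (e : rel T) (A : {set T}) : Prop :=
  forall x y, x \in A -> y \in A -> ~~ e x y.

Definition alpha_le (T : finType) (e : rel T) (k : nat) : Prop :=
  forall A : {set T}, independent e A -> #|A| <= k.

Definition odd_connected_pairing (T : finType) (e : rel T) (s : nat)
    (u v : 'I_s -> T) : Prop :=
  injective u /\ injective v /\ (forall i j, u i != v j) /\
  forall i j, i != j -> e (u i) (u j) \/ e (v i) (v j).

(* Main.v *)
Require Import Defs.
From mathcomp Require Import all_boot all_order all_algebra.
From mathcomp Require Import reals.
From mathcomp Require Import zify.
Set Implicit Arguments. Unset Strict Implicit. Unset Printing Implicit Defensive.
Import Order.TTheory GRing.Theory Num.Theory.

(** The complement [H] of the graph must be triangle-free, and every linear-sized pairing must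
    contain two indices [i != j] such that both [u_i u_j] and [v_i v_j] are edges of [H].  We take
    [H] to be the union of two layers.  Fix a triangle-free graph [B] on [m] vertices, [m] a
    large constant, and give each of the [n] vertices a type in [B] by a balanced map [f].  The
    first layer is a blow-up of [B], of constant density; the second is a sparse triangle-free
    random graph [R] of edge probability about [n^(-3/4)].  Delete from the first layer the pairs
    with a common neighbour in [R] and from the second the pairs whose types have a common
    neighbour in [B]: no triangle survives.

    For a fixed pairing, [R] contains one of the quadratically many suitable pairs [v_i v_j]
    except with probability [exp(- c n^(5/4))], which beats the [n^O(n)] pairings.  It remains
    that quadratically many [i, j] have types with [f u_i, f u_j] adjacent in [B] and [f v_i, f v_j]
    without common neighbour in [B].  As [m] is constant, it suffices to find two suitable
    type pairs taken by linearly many indices, and these come from the same random graph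
    statement, applied to [B] and a matching of types. *)

(** * Counting colourings with prescribed zero or nonzero values *)

Lemma card_zero_on (W : finType) (k : nat) (E : {set W}) :
  #|[set c : {ffun W -> 'I_k.+1} | [forall e in E, c e == ord0]]| * k.+1 ^ #|E|
  = k.+1 ^ #|W|.
Proof.
pose F (w : W) : pred 'I_k.+1 := if w \in E then pred1 ord0 else predT.
have -> : #|[set c : {ffun W -> 'I_k.+1} | [forall e in E, c e == ord0]]|
          = #|(family F : pred {ffun W -> 'I_k.+1})|.
  apply: eq_card => c; rewrite inE; apply/forall_inP/familyP => [h w|h e eE].
    by rewrite /F; case: ifP => // /h.
  by have := h e; rewrite /F eE inE.
rewrite card_family foldrE big_map big_enum /=.
rewrite (eq_bigr (fun w => if w \in E then 1 else k.+1)); last first.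
  by move=> w _; rewrite /F; case: ifP => _; rewrite ?card1 ?card_ord.
rewrite (bigID (fun w => w \in E)) /= big1 ?mul1n; last by move=> i ->.
rewrite -[k.+1 ^ #|E|]prod_nat_const.
rewrite (eq_bigr (fun=> k.+1)); last by move=> i /negbTE ->.
by rewrite mulnC -(bigID (fun w => w \in E) predT (fun=> k.+1)) /= prod_nat_const.
Qed.

(* Recolouring [c] arbitrarily on [g] elements of [Q c] does not change [Q c], so [c] is recovered
   from the recoloured function and its old, nonzero colours there. *)
Lemma card_avoid (W : finType) (k g : nat) (J : {set W})
    (Q : {ffun W -> 'I_k.+1} -> {set W}) (A : {set {ffun W -> 'I_k.+1}}) :
  (forall c, Q c \subset J) ->
  (forall c c' : {ffun W -> 'I_k.+1}, (forall w, w \notin J -> c w = c' w) -> Q c = Q c') ->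
  (forall c : {ffun W -> 'I_k.+1}, c \in A -> g <= #|Q c| /\ forall e, e \in Q c -> c e != ord0) ->
  #|A| * k.+1 ^ g <= k ^ g * k.+1 ^ #|W|.
Proof.
move=> QJ Qc hA.
case: (leqP #|A| 0) => [|/card_gt0P [c0 c0A]]; first by rewrite leqn0 => /eqP ->.
case: (posnP g) => [->|g0].
  rewrite !expn0 muln1 mul1n (leq_trans (max_card _)) //.
  by rewrite card_ffun card_ord.
have [w0 _] : exists w, w \in Q c0.
  by apply/card_gt0P; apply: leq_trans g0 (hA _ c0A).1.
pose nt (c : {ffun W -> 'I_k.+1}) (i : nat) := nth w0 (enum (Q c)) i.
(* [insub] succeeds exactly on the first [g] elements of [enum (Q c)], and only these are
   recoloured, by [t]. The first component of [ph] stores their old colours. *)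
pose md (c : {ffun W -> 'I_k.+1}) (t : {ffun 'I_g -> 'I_k.+1}) :=
  [ffun w => if insub (index w (enum (Q c))) is Some i then t i else c w].
pose ph (p : {ffun W -> 'I_k.+1} * {ffun 'I_g -> 'I_k.+1}) :=
  ([ffun i : 'I_g => p.1 (nt p.1 i)], md p.1 p.2).
pose B := setX A [set: {ffun 'I_g -> 'I_k.+1}].
pose C := setX [set t : {ffun 'I_g -> 'I_k.+1} | t \in ffun_on (predC1 ord0)]
            [set: {ffun W -> 'I_k.+1}].
have cB : #|B| = #|A| * k.+1 ^ g by rewrite cardsX cardsT card_ffun !card_ord.
have cC : #|C| = k ^ g * k.+1 ^ #|W|.
  rewrite cardsX cardsE card_ffun_on cardsT card_ffun !card_ord.
  by rewrite cardC1 card_ord.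
rewrite -cB -cC.
have Qsz c : c \in A -> g <= size (enum (Q c)) by move=> /hA [h _]; rewrite -cardE.
have QM c t : c \in A -> Q (md c t) = Q c.
  move=> cA; apply: Qc => w wJ; rewrite ffunE.
  case: insubP => // i lt _; move: lt.
  rewrite memNindex ?ltnNge ?(Qsz _ cA) // mem_enum.
  by apply: contra wJ; apply/subsetP.
have pinj : {in B &, injective ph}.
  move=> [c t] [c' t']; rewrite !inE !andbT /= => cA cA' [e1 e2].
  have eQ : Q c = Q c' by rewrite -(QM c t cA) -(QM c' t' cA') e2.
  have en i : nt c i = nt c' i by rewrite /nt eQ.
  have ind (i : 'I_g) : index (nt c i) (enum (Q c)) = i.
    by rewrite index_uniq ?enum_uniq // (leq_trans (ltn_ord i)) ?Qsz.
  have et : t = t'.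
    apply/ffunP => i; move/ffunP/(_ (nt c i)): e2.
    by rewrite !ffunE -eQ ind valK.
  congr pair => //; apply/ffunP => w.
  case: (ltnP (index w (enum (Q c))) g) => [lt|ge].
    have wE : w = nt c (Ordinal lt).
      by rewrite /nt /= nth_index // -index_mem (leq_trans lt) ?Qsz.
    by move/ffunP/(_ (Ordinal lt)): e1; rewrite !ffunE /= -en -wE.
  by move/ffunP/(_ w): e2; rewrite !ffunE -eQ insubN // -leqNgt.
rewrite -(card_in_imset pinj); apply/subset_leq_card/subsetP => _ /imsetP [[c t] + ->].
rewrite !inE !andbT /= => cA; apply/ffun_onP => i; rewrite ffunE inE.
apply: (hA _ cA).2; rewrite -mem_enum mem_nth //.
exact: leq_trans (ltn_ord i) (Qsz _ cA).
Qed.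

(** * Random graphs *)

Definition triangle_free (T : finType) (e : rel T) : Prop :=
  forall x y z, e x y -> e y z -> e x z -> False.

Definition common_nbr (T : finType) (e : rel T) : rel T :=
  fun x y => [exists z, e x z && e y z].

(** Markov's inequality without division: the sum of [#|S c|] over all outcomes is counted by
    elements instead, each contributing at most [b / a]. *)
Lemma markov_card (O I : finType) (S : O -> {set I}) (t a b : nat) :
  (forall i, #|[set c | i \in S c]| * a <= b) ->
  #|[set c | t <= #|S c|]| * t * a <= #|I| * b.
Proof.
move=> h.
apply: (@leq_trans ((\sum_(c : O) #|S c|) * a)).
  rewrite leq_mul2r; apply/orP; right.
  rewrite -sum_nat_const [X in _ <= X](bigID (fun c => t <= #|S c|)) /=.
  apply: leq_trans (leq_addr _ _).
  by rewrite (eq_bigl (fun c => t <= #|S c|)) ?leq_sum // => c; rewrite inE.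
have -> : \sum_(c : O) #|S c| = \sum_(i : I) #|[set c | i \in S c]|.
  rewrite (eq_bigr (fun c => \sum_(i : I) (i \in S c))); last first.
    by move=> c _; rewrite -sum1_card [LHS]big_mkcond; apply: eq_bigr => i _; case: (i \in S c).
  rewrite exchange_big; apply: eq_bigr => i _.
  by rewrite -sum1_card [RHS]big_mkcond; apply: eq_bigr => c _; rewrite inE; case: (i \in S c).
rewrite big_distrl /= -sum_nat_const; exact: leq_sum.
Qed.

Lemma bernoulli_nat (k j : nat) : k ^ j * (k + j) <= k * k.+1 ^ j.
Proof.
elim: j => [|j IH]; first by rewrite !expn0 addn0 mulnC.
rewrite !expnS; nia.
Qed.

(** By Bernoulli, [(1 + 1/k)^(k+1)] is at least 2, so each block of [k.+1] factors [k / k.+1] costs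
    at least one factor 2. *)
Lemma half_decay (k g : nat) : k ^ g * 2 ^ (g %/ k.+1) <= k.+1 ^ g.
Proof.
have h2 : k ^ k.+1 * 2 <= k.+1 ^ k.+1.
  case: k => [|k]; first by rewrite exp0n.
  have := bernoulli_nat k.+1 k.+2; nia.
rewrite {1 3}(divn_eq g k.+1) !expnD !(mulnC (g %/ k.+1)) !expnM mulnAC.
rewrite leq_mul //; last by case: (g %% k.+1) => // r; rewrite leq_exp2r.
rewrite -expnMn; case: (g %/ k.+1) => // r; by rewrite leq_exp2r.
Qed.

Section RandomGraph.
Variables (N k : nat).
Local Notation W := ('I_N * 'I_N)%type.
Local Notation Om := {ffun W -> 'I_k.+1}.

(** Each unordered pair carries two independent uniform colours and is an edge when one of them
    vanishes, so the edge probability is at most [2 / k.+1]. *)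
Definition cgraph (c : Om) : rel 'I_N :=
  fun x y => (x != y) && ((c (x, y) == ord0) || (c (y, x) == ord0)).

Lemma cgraph_irr (c : Om) : irreflexive (cgraph c).
Proof. by move=> x; rewrite /cgraph eqxx. Qed.

Lemma cgraph_sym (c : Om) : symmetric (cgraph c).
Proof. by move=> x y; rewrite /cgraph eq_sym orbC. Qed.

Definition swap (p : W) : W := (p.2, p.1).

(** Union bound over the [2 ^ size s] ways to choose which of the two colours of each edge vanishes;
    the [uniq] hypothesis excludes loops and repeated edges, so the chosen colours are
    independent. *)
Lemma card_cgraph_edges (s : seq W) : uniq (s ++ map swap s) ->
  #|[set c : Om | all (fun p => cgraph c p.1 p.2) s]| * k.+1 ^ size s
  <= 2 ^ size s * k.+1 ^ (N * N).
Proof.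
case: s => [|d s0]; first by rewrite !expn0 muln1 mul1n (leq_trans (max_card _)) // card_ffun card_prod !card_ord.
move: (d :: s0) => s; set r := size s => us.
(* A shift by [r] in [s ++ map swap s] reverses a pair; [o i] tells whether the [i]-th pair is
   reversed. *)
pose E (o : {ffun 'I_r -> bool}) (i : 'I_r) := nth d (s ++ map swap s) (i + o i * r).
have Einj o : injective (E o).
  move=> i j /eqP; rewrite /E nth_uniq //; last first.
  - rewrite size_cat size_map -/r; have := ltn_ord j; case: (o j); lia.
  - rewrite size_cat size_map -/r; have := ltn_ord i; case: (o i); lia.
  move=> /eqP h; apply: val_inj => /=; have := ltn_ord i; have := ltn_ord j; move: h.
  case: (o i); case: (o j); lia.
have sub : [set c : Om | all (fun p => cgraph c p.1 p.2) s] \subset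
    \bigcup_(o : {ffun 'I_r -> bool}) [set c : Om | [forall e in [set E o i | i in 'I_r], c e == ord0]].
  apply/subsetP => c; rewrite inE => /allP hc.
  apply/bigcupP; exists [ffun i : 'I_r => c (nth d s i) != ord0] => //.
  rewrite inE; apply/forall_inP => e /imsetP [i _ ->]; rewrite /E ffunE.
  have := hc (nth d s i) (mem_nth _ (ltn_ord i)); rewrite /cgraph -surjective_pairing.
  case/andP=> _; case: eqP => /= [h _|_ h].
    by rewrite mul0n addn0 nth_cat ltn_ord h.
  by rewrite mul1n nth_cat ltnNge leq_addl /= addnK (nth_map d) ?ltn_ord.
have -> : 2 ^ r = \sum_(o : {ffun 'I_r -> bool}) 1 by rewrite sum1_card card_ffun card_bool card_ord.
apply: leq_trans (_ : (\sum_(o : {ffun 'I_r -> bool}) #|[set c : Om | [forall e in [set E o i | i in 'I_r], c e == ord0]]|) * k.+1 ^ r <= _).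
  rewrite leq_mul2r; apply/orP; right; apply: leq_trans (subset_leq_card sub) _.
  elim/big_rec2: _ => [|o y1 y2 _ h]; first by rewrite cards0.
  by rewrite (leq_trans (leq_card_setU _ _).1) // leq_add2l.
rewrite !big_distrl /=; apply: leq_sum => o _; rewrite mul1n.
have := @card_zero_on W k [set E o i | i in 'I_r].
by rewrite card_imset // card_prod !card_ord => ->.
Qed.

Definition triangles (c : Om) : {set 'I_N * 'I_N * 'I_N} :=
  [set t | [&& cgraph c t.1.1 t.1.2, cgraph c t.1.2 t.2 & cgraph c t.1.1 t.2]].

Definition cherries (c : Om) : {set 'I_N * 'I_N * 'I_N} :=
  [set t | [&& t.1.1 != t.1.2, cgraph c t.1.1 t.2 & cgraph c t.1.2 t.2]].

Lemma card_many_triangles (t : nat) :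
  #|[set c | t <= #|triangles c|]| * t * k.+1 ^ 3 <= N ^ 3 * (8 * k.+1 ^ (N * N)).
Proof.
have -> : N ^ 3 = #|{: 'I_N * 'I_N * 'I_N}| by rewrite !card_prod card_ord !expnS; lia.
apply: markov_card => -[[x y] z] /=.
case: (boolP [&& x != y, y != z & x != z]) => [/and3P [xy yz xz]|h]; last first.
  rewrite (_ : [set _ | _] = set0) ?cards0 //; apply/setP => c; rewrite !inE /=.
  by apply/negbTE; apply: contra h; rewrite /cgraph => /and3P [/andP [-> _] /andP [-> _] /andP [-> _]].
have := @card_cgraph_edges [:: (x, y); (y, z); (x, z)]; rewrite /= !inE !xpair_eqE.
rewrite !(eq_sym y x) !(eq_sym z) (negbTE xy) (negbTE yz) (negbTE xz) !andbF !andFb /= => /(_ isT).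
apply: leq_trans; rewrite leq_mul2r; apply/orP; right.
by apply: subset_leq_card; apply/subsetP => c; rewrite !inE /= andbT.
Qed.

(** Cherries bound the number of pairs of distinct vertices with a common neighbour, which are the
    pairs lost in [open_pairs]. *)
Lemma card_many_cherries (t : nat) :
  #|[set c | t <= #|cherries c|]| * t * k.+1 ^ 2 <= N ^ 3 * (4 * k.+1 ^ (N * N)).
Proof.
have -> : N ^ 3 = #|{: 'I_N * 'I_N * 'I_N}| by rewrite !card_prod card_ord !expnS; lia.
apply: markov_card => -[[x y] z] /=.
case: (boolP [&& x != y, y != z & x != z]) => [/and3P [xy yz xz]|h]; last first.
  rewrite (_ : [set _ | _] = set0) ?cards0 //; apply/setP => c; rewrite !inE /=.
  by apply/negbTE; apply: contra h; rewrite /cgraph => /and3P [-> /andP [-> _] /andP [-> _]].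
have := @card_cgraph_edges [:: (x, z); (y, z)]; rewrite /= !inE !xpair_eqE.
rewrite !(eq_sym z) (negbTE xy) (negbTE yz) (negbTE xz) !andbF !andFb /= => /(_ isT).
apply: leq_trans; rewrite leq_mul2r; apply/orP; right.
apply: subset_leq_card; apply/subsetP => c; rewrite !inE /= andbT => /and3P [_ -> ->] //.
Qed.

Section Fail.
Variable Z : 'I_N -> 'I_N -> 'I_N -> 'I_N -> bool.

(** A pairing is encoded by the set [U] of its first coordinates and the map [w] from [u_i] to
    [v_i]. At an open pair, an edge between the images under [w] is all that is still wanted. *)
Definition open_pairs (U : {set 'I_N}) (w : {ffun 'I_N -> 'I_N}) (c : Om) : {set W} :=
  [set p | [&& p.1 \in U, p.2 \in U, p.1 != p.2, Z p.1 p.2 (w p.1) (w p.2)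
             & ~~ common_nbr (cgraph c) p.1 p.2]].

(** Only one of the two colours of the image pair is tested: if it vanishes, the edge is there
    already. *)
Definition fail_set (g : nat) (U : {set 'I_N}) (w : {ffun 'I_N -> 'I_N}) : {set Om} :=
  [set c | (g <= #|open_pairs U w c|)
         && [forall p in open_pairs U w c, c (w p.1, w p.2) != ord0]].

Definition pairing_map (U : {set 'I_N}) (w : {ffun 'I_N -> 'I_N}) : bool :=
  [forall x in U, forall y in U, (w x == w y) ==> (x == y)]
  && [forall x in U, w x \notin U].

(* The common neighbours of pairs in [U] are read off colours of pairs meeting [U], hence
   outside [w U * w U], where the colours stay uniform once the former are fixed. *)
Lemma card_fail_set (g : nat) (U : {set 'I_N}) (w : {ffun 'I_N -> 'I_N}) :
  pairing_map U w -> #|fail_set g U w| * k.+1 ^ g <= k ^ g * k.+1 ^ (N * N).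
Proof.
case/andP=> /forall_inP winj /forall_inP wU.
have wi : {in U &, injective w}.
  move=> x y xU yU e; have /forall_inP /(_ y yU) := winj x xU.
  by rewrite e eqxx => /eqP.
have -> : N * N = #|{: W}| by rewrite card_prod card_ord.
pose V := w @: U.
have UV x : x \in U -> x \notin V.
  by move=> xU; apply/negP => /imsetP [y /wU] + exy; rewrite -exy xU.
pose f (p : W) : W := (w p.1, w p.2).
apply: (@card_avoid W k g (setX V V) (fun c => f @: open_pairs U w c)).
- move=> c; apply/subsetP => _ /imsetP [p + ->]; rewrite inE => /and3P [h1 h2 _].
  by rewrite inE; apply/andP; split; apply: imset_f.
- move=> c c' cc'; suff -> : open_pairs U w c = open_pairs U w c' by [].
  apply/setP => p; rewrite !inE.
  case: (boolP (p.1 \in U)) => //= h1; case: (boolP (p.2 \in U)) => //= h2.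
  have ec x z : x \in U -> cgraph c x z = cgraph c' x z.
    by move=> /UV xV; rewrite /cgraph !cc' // inE /= negb_and xV ?orbT.
  congr [&& _, _ & ~~ _]; apply: eq_existsb => z.
  by rewrite !ec.
- move=> c; rewrite inE => /andP [hg /forall_inP hc]; split.
    rewrite card_in_imset // => p q; rewrite !inE => /and3P [p1 p2 _] /and3P [q1 q2 _].
    by case=> /(wi _ _ p1 q1) e1 /(wi _ _ p2 q2) e2; rewrite (surjective_pairing p) e1 e2 -surjective_pairing.
  by move=> e /imsetP [p /hc] + ->.
Qed.

(** Each of the three bad events covers at most a quarter of the colourings. For the third this is a
    union bound over at most [2 ^ N * N ^ N] pairs [(U, w)], each failing with probability at most
    [2 ^ -(g %/ k.+1)]. *)
Lemma exists_good_coloring (g t1 t2 : nat) :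
  N ^ 3 * 8 * 4 <= t1 * k.+1 ^ 3 ->
  N ^ 3 * 4 * 4 <= t2 * k.+1 ^ 2 ->
  (2 ^ N * N ^ N) * 4 <= 2 ^ (g %/ k.+1) ->
  0 < t1 -> 0 < t2 ->
  exists c : Om, [/\ #|triangles c| < t1, #|cherries c| < t2
    & forall U w, pairing_map U w -> c \notin fail_set g U w].
Proof.
move=> h1 h2 h3 t1p t2p.
pose A1 := [set c : Om | t1 <= #|triangles c|].
pose A2 := [set c : Om | t2 <= #|cherries c|].
pose A3 := \bigcup_(p : {set 'I_N} * {ffun 'I_N -> 'I_N} | pairing_map p.1 p.2) fail_set g p.1 p.2.
set K := k.+1 ^ (N * N).
have Kp : 0 < K by rewrite expn_gt0.
have c1 : #|A1| * 4 <= K.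
  have := card_many_triangles t1; rewrite -/A1 -/K => h.
  have kp : 0 < t1 * k.+1 ^ 3 by rewrite muln_gt0 t1p expn_gt0.
  rewrite -(leq_pmul2r kp); nia.
have c2 : #|A2| * 4 <= K.
  have := card_many_cherries t2; rewrite -/A2 -/K => h.
  have kp : 0 < t2 * k.+1 ^ 2 by rewrite muln_gt0 t2p expn_gt0.
  rewrite -(leq_pmul2r kp); nia.
have c3 : #|A3| * 4 <= K.
  have e1 : #|A3| * k.+1 ^ g <= (2 ^ N * N ^ N) * (k ^ g * K).
    apply: leq_trans (_ : (\sum_(p : {set 'I_N} * {ffun 'I_N -> 'I_N} | pairing_map p.1 p.2)
       #|fail_set g p.1 p.2|) * k.+1 ^ g <= _).
      rewrite leq_mul2r; apply/orP; right; rewrite /A3.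
      elim/big_rec2: _ => [|p y1 y2 _ h]; first by rewrite cards0.
      by rewrite (leq_trans (leq_card_setU _ _).1) // leq_add2l.
    rewrite big_distrl /=.
    apply: leq_trans (_ : \sum_(p : {set 'I_N} * {ffun 'I_N -> 'I_N} | pairing_map p.1 p.2) (k ^ g * K) <= _).
      by apply: leq_sum => p; exact: card_fail_set.
    rewrite sum_nat_const leq_mul2r; apply/orP; right.
    apply: leq_trans (max_card _) _; rewrite card_prod card_ffun card_ord.
    by rewrite -cardsT -powersetT card_powerset cardsT card_ord.
  have e2 := half_decay k g.
  have kp : 0 < k.+1 ^ g by rewrite expn_gt0.
  rewrite -(leq_pmul2r kp).
  apply: leq_trans (_ : (2 ^ (g %/ k.+1)) * (k ^ g * K) <= _).
    rewrite mulnAC; apply: leq_trans (leq_mul e1 (leqnn 4)) _.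
    by rewrite mulnAC leq_mul.
  by rewrite mulnA (mulnC _ (k ^ g)) mulnC leq_mul.
have [c hc] : exists c, c \notin A1 :|: A2 :|: A3.
  apply/existsP; rewrite -negb_forall; apply/negP => /forallP h.
  have eK : #|A1 :|: A2 :|: A3| = K.
    rewrite (_ : _ :|: _ = setT); first by rewrite cardsT card_ffun card_prod !card_ord.
    by apply/setP => c; rewrite h inE.
  have : K <= #|A1| + #|A2| + #|A3|.
    rewrite -eK; apply: leq_trans (leq_card_setU _ _).1 _.
    by rewrite leq_add2r (leq_card_setU _ _).1.
  move: Kp c1 c2 c3; clear; move: #|A1| #|A2| #|A3| K => a1 a2 a3 K; lia.
move: hc; rewrite !inE !negb_or -!ltnNge => /andP [/andP [hc1 hc2] hc3].
exists c; split=> // U w pw; apply: contra hc3 => h.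
by apply/bigcupP; exists (U, w).
Qed.
End Fail.
End RandomGraph.

(** * Removing the triangles *)

Lemma card_preim_inj (I J : finType) (D : {set I}) (f : I -> J) (X : {set J}) :
  {in D &, injective f} -> #|[set i in D | f i \in X]| <= #|X|.
Proof.
move=> fi; rewrite -(@card_in_imset _ _ f); last first.
  by move=> i j; rewrite !inE => /andP [iD _] /andP [jD _]; exact: fi.
by apply/subset_leq_card/subsetP => _ /imsetP [i + ->]; rewrite inE => /andP [].
Qed.

(* Vertices lying in triangles are few, so isolating them costs few of the pairs of indices. *)
Lemma prune_coloring (N k G g t1 t2 : nat)
    (Z : 'I_N -> 'I_N -> 'I_N -> 'I_N -> bool) (c : {ffun 'I_N * 'I_N -> 'I_k.+1}) :
  0 < G -> G * (g + t2 + N + 4 * t1 * N) <= N ^ 2 ->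
  #|triangles c| < t1 -> #|cherries c| < t2 ->
  (forall U w, pairing_map U w -> c \notin fail_set k Z g U w) ->
  exists R : rel 'I_N, [/\ simple_graph R, triangle_free R &
    forall (I : finType) (D : {set I}) (u v : I -> 'I_N),
      {in D &, injective u} -> {in D &, injective v} ->
      (forall i j, i \in D -> j \in D -> u i != v j) ->
      N ^ 2 <= G * #|[set p : I * I | [&& p.1 \in D, p.2 \in D
                       & Z (u p.1) (u p.2) (v p.1) (v p.2)]]| ->
      exists i j, [/\ i \in D, j \in D, Z (u i) (u j) (v i) (v j),
        R (v i) (v j) & ~~ common_nbr R (u i) (u j)]].
Proof.
move=> G0 hnum ht hc hfail.
pose X := (fun t : 'I_N * 'I_N * 'I_N => t.1.1) @: triangles c.
have hX : #|X| < t1 by apply: leq_ltn_trans ht; exact: leq_imset_card.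
exists (fun x y => [&& cgraph c x y, x \notin X & y \notin X]); split.
- split=> [x|x y]; first by rewrite cgraph_irr.
  by rewrite cgraph_sym; congr (_ && _); rewrite andbC.
- move=> x y z /and3P [xy /negP xX _] /and3P [yz _ _] /and3P [xz _ _]; apply: xX.
  by apply/imsetP; exists (x, y, z) => //; rewrite inE /= xy yz xz.
move=> I D u v ui vi uv; set P := [set p : I * I | _] => hP.
pose D' := [set i in D | (u i \notin X) && (v i \notin X)].
have D'D i : i \in D' -> i \in D by rewrite inE => /andP [].
have ui' : {in D' &, injective u} by move=> i j /D'D iD /D'D jD; exact: ui.
pose U := u @: D'.
(* The value [x] outside [U] is a default that no later condition reads. *)
pose w : {ffun 'I_N -> 'I_N} := [ffun x : 'I_N => if [pick i in D' | u i == x] is Some i then v i else x].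
have wu i : i \in D' -> w (u i) = v i.
  move=> iD; rewrite ffunE; case: pickP => [j /andP [jD /eqP /ui' -> //]|/(_ i)].
  by rewrite iD eqxx.
have pw : pairing_map U w.
  apply/andP; split.
    apply/forall_inP => _ /imsetP [i iD ->]; apply/forall_inP => _ /imsetP [j jD ->].
    rewrite !wu //; apply/implyP => /eqP /vi -> //; exact: D'D.
  apply/forall_inP => _ /imsetP [i iD ->]; rewrite wu //; apply/negP => /imsetP [j jD /eqP].
  by rewrite eq_sym; apply/negP/uv; exact: D'D.
pose P' := [set p in P | (p.1 \in D') && (p.2 \in D')].
pose DX := [set i in D | u i \in X] :|: [set i in D | v i \in X].
have cDX : #|DX| <= 2 * #|X|.
  apply: leq_trans (leq_card_setU _ _).1 _; rewrite mul2n -addnn.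
  by apply: leq_add; exact: card_preim_inj.
have cD : #|D| <= N by rewrite -(card_in_imset ui) -[N in _ <= N]card_ord max_card.
have DD' i : i \in D -> i \notin D' -> i \in DX.
  by move=> iD; rewrite !inE iD /= negb_and !negbK.
have sP : P \subset P' :|: setX DX D :|: setX D DX.
  apply/subsetP => -[i j] pP; have := pP; rewrite inE /= => /and3P [p1 p2 _].
  rewrite !in_setU !in_setX p1 p2 andbT [_ \in P']inE pP /=.
  by case: (boolP (i \in D')) => [_|/(DD' _ p1) ->]; case: (boolP (j \in D')) => [_|/(DD' _ p2) ->]; rewrite ?orbT.
(* At most [2 * #|X|] indices are lost, hence at most [4 * #|X| * N] pairs: the term [4 * t1 * N] of
   the numerical hypothesis. *)
have cP : #|P| <= #|P'| + #|X| * 2 * N + N * (#|X| * 2).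
  apply: leq_trans (subset_leq_card sP) _.
  apply: leq_trans (leq_card_setU _ _).1 _; rewrite cardsX leq_add //; last first.
    by rewrite leq_mul // mulnC.
  apply: leq_trans (leq_card_setU _ _).1 _; rewrite cardsX leq_add //.
  by rewrite leq_mul // mulnC.
pose uu (p : I * I) := (u p.1, u p.2).
(* A surviving pair that is not open is diagonal or has a common neighbour; these account for the
   terms [N] and [t2]. *)
have cP' : #|P'| <= #|open_pairs Z U w c| + #|[set (x, x) | x in 'I_N]|
                    + #|(fun t : 'I_N * 'I_N * 'I_N => t.1) @: cherries c|.
  have -> : #|P'| = #|uu @: P'|.
    rewrite card_in_imset // => -[i j] [i' j'].
    rewrite [(i, j) \in P']inE [(i', j') \in P']inE /=.
    move=> /andP [_ /andP [p1 p2]] /andP [_ /andP [q1 q2]] [e1 e2].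
    by rewrite (ui' _ _ p1 q1 e1) (ui' _ _ p2 q2 e2).
  have s : uu @: P' \subset open_pairs Z U w c :|: [set (x, x) | x in 'I_N]
             :|: ((fun t : 'I_N * 'I_N * 'I_N => t.1) @: cherries c).
    apply/subsetP => _ /imsetP [p + ->].
    rewrite inE [p \in P]inE => /andP [/and3P [_ _ hZ] /andP [p1 p2]].
    rewrite !in_setU.
    case: (eqVneq (u p.1) (u p.2)) => [e|ne].
      by apply/orP; left; apply/orP; right; apply/imsetP; exists (u p.1); rewrite // /uu e.
    case: (boolP (common_nbr (cgraph c) (u p.1) (u p.2))) => [/existsP [z /andP [z1 z2]]|nc].
      by apply/orP; right; apply/imsetP; exists (u p.1, u p.2, z) => //; rewrite inE /= ne z1 z2.
    by rewrite [_ \in open_pairs _ _ _ _]inE /= !wu // hZ ne nc !imset_f.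
  apply: leq_trans (subset_leq_card s) _.
  apply: leq_trans (leq_card_setU _ _).1 _; rewrite leq_add2r.
  exact: (leq_card_setU _ _).1.
have dN : #|[set (x, x) | x in 'I_N]| <= N.
  by apply: leq_trans (leq_imset_card _ _) _; rewrite card_ord.
have dC := leq_imset_card (fun t : 'I_N * 'I_N * 'I_N => t.1) (cherries c).
have hg : g <= #|open_pairs Z U w c|.
  have : g + t2 + N + 4 * t1 * N <= #|P|.
    by rewrite -(leq_pmul2l G0) (leq_trans hnum).
  have : (#|X| * N).*2.*2 <= (t1 * N).*2.*2 by rewrite !leq_double leq_mul2r (ltnW hX) orbT.
  move: cP cP' dN dC hc.
  move: #|P| #|P'| #|open_pairs _ _ _ _| #|X| #|cherries c| #|imset _ _| #|imset _ _| => a1 a2 a3 a4 a5 a6 a7.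
  clear; lia.
have := hfail U w pw; rewrite inE hg /= => /forall_inPn [p].
rewrite inE => /and5P [/imsetP [i iD ->] /imsetP [j jD ->] ne hZ hn].
rewrite negbK !wu // => /eqP h0; rewrite !wu // in hZ.
exists i, j; split=> //; try exact: D'D.
  have := iD; have := jD; rewrite !inE => /andP [_ /andP [_ ->]] /andP [_ /andP [_ ->]].
  rewrite /cgraph h0 eqxx !andbT; apply: contra ne => /eqP /vi -> //; exact: D'D.
apply: contra hn => /existsP [z /andP [/and3P [h1 _ _] /and3P [h2 _ _]]].
by apply/existsP; exists z; rewrite h1 h2.
Qed.

(** * Choice of the parameters *)

Lemma linear_leq_exp2 (y : nat) : 20 <= y -> (8 * y + 6) * 8 <= 2 ^ y.
Proof.
elim: y => // y IH; rewrite leq_eqVlt => /orP [/eqP <-|y20]; last first.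
  by have := IH y20; rewrite expnS; lia.
by rewrite (expnD 2 10 10) -[2 ^ 10]/1024; lia.
Qed.

Lemma leq_double_divn (N d : nat) : 0 < d <= N -> N <= 2 * d * (N %/ d).
Proof.
case/andP=> d0 dN.
have q0 : 0 < N %/ d by rewrite divn_gt0.
have q1 : (N %/ d).+1 <= 2 * (N %/ d) by lia.
apply: ltnW; apply: leq_trans (ltn_ceil N d0) _.
by apply: leq_trans (leq_mul q1 (leqnn d)) _; rewrite mulnAC.
Qed.

(* With [q = 2^b] and [q^4 <= N < 16 q^4], the edge probability is [q^-3]. *)
Lemma random_parameters (G N : nat) : 0 < G -> 16 ^ (2 * G + 40) <= N ->
  exists k g t1 t2, [/\ N ^ 3 * 8 * 4 <= t1 * k.+1 ^ 3, N ^ 3 * 4 * 4 <= t2 * k.+1 ^ 2,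
    (2 ^ N * N ^ N) * 4 <= 2 ^ (g %/ k.+1), 0 < t1 /\ 0 < t2
    & G * (g + t2 + N + 4 * t1 * N) <= N ^ 2].
Proof.
move=> G0 hN.
have N0 : 0 < N by apply: leq_trans hN; rewrite expn_gt0.
have [b [hb bN Nb]] : exists b, [/\ 2 * G + 40 <= b, 16 ^ b <= N & N < 16 ^ b.+1].
  have /andP [h1 h2] := trunc_log_bounds (isT : 1 < 16) N0.
  exists (trunc_log 16 N); split=> //; rewrite -ltnS -(@ltn_exp2l 16) //.
  exact: leq_ltn_trans hN h2.
have [q hq] : exists q, q = 2 ^ b by exists (2 ^ b).
have e8 : 8 ^ b = q ^ 3 by rewrite hq -expnM mulnC expnM.
have e16 : 16 ^ b = q ^ 4 by rewrite hq -expnM mulnC expnM.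
have G2 : G <= 2 ^ G by apply: ltnW; exact: ltn_expl.
have qG : q = 2 ^ G * 2 ^ (b - G) by rewrite hq -expnD subnKC //; lia.
(* The constant is [1024 * 256], exactly what the triangle estimate below needs. *)
have q1 : 512 * 512 * G <= q.
  have : 2 ^ 18 <= 2 ^ (b - G) by rewrite leq_exp2l //; lia.
  rewrite (expnD 2 9 9) -[2 ^ 9]/512 qG [X in _ -> _ <= X]mulnC => h; exact: leq_mul.
(* Here [4 * b + 4] bounds the binary logarithm of [N]: the inequality pays for the [N ^ N] maps in
   the union bound. *)
have q2 : (4 * b + 6) * 8 * G <= q.
  rewrite qG [X in _ <= X]mulnC leq_mul //.
  apply: leq_trans (_ : (8 * (b - G) + 6) * 8 <= _); first by lia.
  by apply: linear_leq_exp2; lia.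
rewrite expnS e16 in Nb; rewrite e16 in bN.
have q0 : 0 < q by rewrite hq expn_gt0.
have NG : 512 * 512 * G <= N.
  by apply: leq_trans q1 (leq_trans _ bN); rewrite -[X in X <= _]expn1 leq_pexp2l.
(* After multiplication by [G], each of [g], [t2] and [4 * t1 * N] takes at most a quarter of
   [N ^ 2]; the last quarter absorbs the term [N]. *)
exists (8 ^ b).-1, (N ^ 2 %/ (4 * G)), (N %/ (16 * G)), (N ^ 2 %/ (4 * G)).
have ek : (8 ^ b).-1.+1 = q ^ 3 by rewrite prednK ?expn_gt0.
rewrite ek.
set t1 := N %/ (16 * G); set t2 := N ^ 2 %/ (4 * G).
have t1l : 16 * G * t1 <= N by rewrite mulnC leq_trunc_div.
have t2l : 4 * G * t2 <= N ^ 2 by rewrite mulnC leq_trunc_div.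
have t1g : N <= 32 * G * t1.
  by have := @leq_double_divn N (16 * G); rewrite mulnA; apply; lia.
have NN : N <= N ^ 2 by rewrite -[X in X <= _]expn1 leq_pexp2l.
have t2g : N ^ 2 <= 8 * G * t2.
  by have := @leq_double_divn (N ^ 2) (4 * G); rewrite mulnA; apply; lia.
split.
- apply: (@leq_trans (32 * G * t1 * N ^ 2 * 32)).
    rewrite (expnS N 2); have := leq_mul t1g (leqnn (N ^ 2)); clear; lia.
  have : 1024 * G * N ^ 2 <= q ^ 9.
    apply: (@leq_trans (1024 * G * (256 * q ^ 8))).
      rewrite leq_mul2l; apply/orP; right.
      have : N ^ 2 <= (16 * q ^ 4) ^ 2 by rewrite leq_exp2r // ltnW.
      by rewrite expnMn -expnM.
    rewrite (expnS q 8); have := leq_mul q1 (leqnn (q ^ 8)); clear; lia.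
  rewrite -expnM => h; have := leq_mul (leqnn t1) h; clear; lia.
- apply: (@leq_trans (8 * G * t2 * N * 16)).
    rewrite (expnS N 2); have := leq_mul t2g (leqnn N); clear; lia.
  have : 128 * G * N <= q ^ 6.
    apply: (@leq_trans (128 * G * (16 * q ^ 4))).
      rewrite leq_mul2l; apply/orP; right; exact: ltnW.
    apply: (@leq_trans (q * q ^ 4)).
      have := leq_mul q1 (leqnn (q ^ 4)); clear; lia.
    by rewrite -expnS leq_pexp2l.
  rewrite -expnM => h; have := leq_mul (leqnn t2) h; clear; lia.
- have N2 : N <= 2 ^ (4 * b + 4).
    by rewrite expnD mulnC (mulnC 4 b) expnM -hq; exact: ltnW.
  apply: (@leq_trans (2 ^ (N + (4 * b + 4) * N + 2))).
    rewrite !expnD leq_mul // leq_mul // expnM leq_exp2r //.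
  rewrite leq_exp2l // leq_divRL ?expn_gt0 ?q0 //.
  have h : (4 * b + 6) * 8 * G * q ^ 3 <= N.
    by apply: leq_trans bN; rewrite (expnS q 3) leq_mul2r q2 orbT.
  have h' : N * ((4 * b + 6) * 8 * G * q ^ 3) <= 8 * G * t2.
    by apply: leq_trans t2g; rewrite (expnS N 1) expn1 leq_mul2l h orbT.
  have G8 : 0 < 8 * G by rewrite muln_gt0.
  rewrite -(leq_pmul2l G8); apply: leq_trans h'.
  have : N + (4 * b + 4) * N + 2 <= N * (4 * b + 6) by move: NG G0; clear; lia.
  move=> /leq_mul /(_ (leqnn (q ^ 3 * (8 * G)))); clear; lia.
- by split; rewrite divn_gt0; move: NG NN G0; clear; lia.
- have : N * (16 * G * t1) <= N * N by rewrite leq_mul2l t1l orbT.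
  have : N * (512 * 512 * G) <= N * N by rewrite leq_mul2l NG orbT.
  move: t2l; rewrite -!mulnn; clear; lia.
Qed.

(** [R] depends on [Z] but serves all pairings at once. A trivial [Z] will give the host graph on
    the types, a condition on types the sparse layer. *)
Lemma pseudorandom_triangle_free (G : nat) : 0 < G -> exists N0, forall N, N0 <= N ->
  forall Z : 'I_N -> 'I_N -> 'I_N -> 'I_N -> bool,
  exists R : rel 'I_N, [/\ simple_graph R, triangle_free R &
    forall (I : finType) (D : {set I}) (u v : I -> 'I_N),
      {in D &, injective u} -> {in D &, injective v} ->
      (forall i j, i \in D -> j \in D -> u i != v j) ->
      N ^ 2 <= G * #|[set p : I * I | [&& p.1 \in D, p.2 \in D
                       & Z (u p.1) (u p.2) (v p.1) (v p.2)]]| ->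
      exists i j, [/\ i \in D, j \in D, Z (u i) (u j) (v i) (v j),
        R (v i) (v j) & ~~ common_nbr R (u i) (u j)]].
Proof.
move=> G0; exists (16 ^ (2 * G + 40)) => N hN Z.
have [k [g [t1 [t2 [h1 h2 h3 [p1 p2] h4]]]]] := random_parameters G0 hN.
have [c [c1 c2 c3]] := exists_good_coloring Z h1 h2 h3 p1 p2.
exact: prune_coloring G0 h4 c1 c2 c3.
Qed.

(** * Heavy type pairs *)

(** With [Z] always true, all [#|D| ^ 2] pairs of indices qualify, whence the density parameter
    [L ^ 2]. *)
Lemma exists_host (L : nat) : 0 < L -> exists N0, forall m, N0 <= m ->
  exists B : rel 'I_m, [/\ simple_graph B, triangle_free B &
    forall (I : finType) (D : {set I}) (u v : I -> 'I_m),
      {in D &, injective u} -> {in D &, injective v} ->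
      (forall i j, i \in D -> j \in D -> u i != v j) ->
      m <= L * #|D| ->
      exists i j, [/\ i \in D, j \in D, B (v i) (v j) & ~~ common_nbr B (u i) (u j)]].
Proof.
move=> L0; have [|N0 hN] := @pseudorandom_triangle_free (L ^ 2); first by rewrite expn_gt0 L0.
exists N0 => m /hN /(_ (fun _ _ _ _ => true)) [B [sB tB hB]]; exists B; split=> //.
move=> I D u v ui vi uv hD.
have [|i [j [iD jD _ h1 h2]]] := hB I D u v ui vi uv; last by exists i, j.
rewrite (_ : [set _ | _] = setX D D); last by apply/setP => p; rewrite !inE andbT.
by rewrite cardsX mulnn -expnMn leq_exp2r.
Qed.

Lemma card_le_fibers (I T : finType) (D : {set I}) (S : {set T}) (t : I -> T) (h : nat) :
  (forall i, i \in D -> t i \in S) ->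
  (forall a, a \in S -> #|[set i in D | t i == a]| <= h) -> #|D| <= #|S| * h.
Proof.
move=> tS hh; rewrite -sum1_card (partition_big t (mem S)) //= -sum_nat_const.
apply: leq_sum => a aS; apply: leq_trans (hh a aS); rewrite -sum1_card.
by rewrite leq_eqVlt; apply/orP; left; apply/eqP; apply: eq_bigl => i; rewrite inE.
Qed.

Section HeavyCells.
Variables (m n E s cls h : nat) (B : rel 'I_m) (f : 'I_n -> 'I_m) (u v : 'I_s -> 'I_n).
Hypothesis hB : forall (I : finType) (D : {set I}) (x y : I -> 'I_m),
  {in D &, injective x} -> {in D &, injective y} ->
  (forall i j, i \in D -> j \in D -> x i != y j) ->
  m <= 32 * E * #|D| ->
  exists i j, [/\ i \in D, j \in D, B (y i) (y j) & ~~ common_nbr B (x i) (x j)].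
Hypothesis tB : triangle_free B.
Hypothesis hcls : forall a, #|[set x | f x == a]| <= cls.
Hypotheses (mcls : m * cls <= 2 * n) (mE : 8 * E < m) (n0 : 0 < n).
Hypotheses (hh : 4 * (m * m) * h * E <= n) (nE : n <= E * s).
Hypotheses (ui : injective u) (vi : injective v).

Definition cell (i : 'I_s) : {set 'I_s} := [set k | (f (u k) == f (u i)) && (f (v k) == f (v i))].

(** There are only [m * m] type pairs, each light one holding fewer than [h] indices. By [hh] and
    [nE] the bound is at most [s / 4]. *)
Lemma card_light : #|[set i | #|cell i| < h]| <= m * m * h.
Proof.
have := @card_le_fibers _ _ [set i | #|cell i| < h] [set: 'I_m * 'I_m]
  (fun i => (f (u i), f (v i))) h.
rewrite cardsT card_prod card_ord; apply=> // -[a b] _.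
case: (set_0Vmem [set i in [set i | #|cell i| < h] | (f (u i), f (v i)) == (a, b)]) => [->|[i]].
  by rewrite cards0.
rewrite !inE => /andP [ic /eqP [ea eb]]; apply: leq_trans (ltnW ic).
by apply/subset_leq_card/subsetP => k; rewrite !inE ea eb => /andP [_ /eqP [-> ->]]; rewrite !eqxx.
Qed.

Lemma card_meet (w : 'I_s -> 'I_n) (S : {set 'I_m}) :
  injective w -> #|[set i | f (w i) \in S]| <= #|S| * cls.
Proof.
move=> wi; apply: (@card_le_fibers _ _ _ _ (fun i => f (w i))) => [i|a _]; first by rewrite inE.
apply: leq_trans (hcls a).
have wi' : {in [set i | f (w i) \in S] &, injective w} by move=> i j _ _; exact: wi.
apply: leq_trans (card_preim_inj [set x | f x == a] wi').
by apply/subset_leq_card/subsetP => i; rewrite !inE.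
Qed.

(* The types of the [v]'s play the role of the first component in [hB], those of the [u]'s
   that of the second. *)
Definition heavy_pair (i j : 'I_s) : Prop :=
  [/\ h <= #|cell i|, h <= #|cell j|, B (f (u i)) (f (u j)) & ~~ common_nbr B (f (v i)) (f (v j))].

(* The types met by a maximal matching of heavy cells cover all heavy off-diagonal cells. *)
Lemma heavy_pair_off_diagonal :
  s <= 4 * #|[set i | (h <= #|cell i|) && (f (u i) != f (v i))]| -> exists i j, heavy_pair i j.
Proof.
set F := [set i | _] => hF.
pose P (D : {set 'I_s}) := (D \subset F) && [forall i in D, forall j in D,
  [&& (f (u i) == f (u j)) ==> (i == j), (f (v i) == f (v j)) ==> (i == j) & f (u i) != f (v j)]].
have P0 : P set0 by rewrite /P sub0set; apply/forall_inP => i; rewrite inE.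
have [D /maxsetP [PD Dmax] _] := maxset_exists P0.
have /andP [DF /forall_inP PD'] := PD.
have Dp i j : i \in D -> j \in D -> [/\ f (u i) = f (u j) -> i = j,
    f (v i) = f (v j) -> i = j & f (u i) != f (v j)].
  move=> iD jD; have /forall_inP /(_ j jD) /and3P [/implyP h1 /implyP h2 h3] := PD' i iD.
  by split=> // /eqP; [move/h1/eqP|move/h2/eqP].
pose S := [set f (u i) | i in D] :|: [set f (v i) | i in D].
have cS : #|S| <= 2 * #|D|.
  apply: leq_trans (leq_card_setU _ _).1 _; rewrite mul2n -addnn.
  by apply: leq_add; exact: leq_imset_card.
have FS k : k \in F -> (f (u k) \in S) || (f (v k) \in S).
  move=> kF; rewrite -[_ || _]negbK negb_or; apply/negP => /andP [uS vS].
  have uu i : i \in D -> f (u k) != f (u i) /\ f (u k) != f (v i).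
    by move=> iD; split; apply: contra uS => /eqP ->; rewrite inE imset_f ?orbT.
  have vv i : i \in D -> f (v k) != f (u i) /\ f (v k) != f (v i).
    by move=> iD; split; apply: contra vS => /eqP ->; rewrite inE imset_f ?orbT.
  have kD : k \notin D by apply: contra uS => kD; rewrite inE imset_f.
  have : P (k |: D).
    apply/andP; split; first by rewrite subUset sub1set kF.
    apply/forall_inP => i; rewrite in_setU1 => iD; apply/forall_inP => j; rewrite in_setU1 => jD.
    case/predU1P: iD => [->|iD]; case/predU1P: jD => [->|jD].
    - by rewrite !eqxx /=; have := kF; rewrite inE => /andP [].
    - by have [/negbTE -> ->] := uu j jD; have [_ /negbTE ->] := vv j jD.
    - have [e1 _] := uu i iD; have [e3 e2] := vv i iD.
      by rewrite (eq_sym _ (f (u k))) (negbTE e1) !(eq_sym _ (f (v k))) (negbTE e2) e3.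
    - by have /forall_inP /(_ j jD) := PD' i iD.
  move/Dmax => /(_ (subsetUr _ _)) e.
  by move/negP: kD; apply; rewrite -e setU11.
have cF : #|F| <= #|S| * cls + #|S| * cls.
  apply: (@leq_trans #|[set i | f (u i) \in S] :|: [set i | f (v i) \in S]|).
    by apply/subset_leq_card/subsetP => k /FS; rewrite in_setU [in X in _ -> X]inE [_ \in [set i | f (v i) \in S]]inE.
  by apply: leq_trans (leq_card_setU _ _).1 _; apply: leq_add; exact: card_meet.
(* Combining [s <= 4 * #|F|], [#|F| <= 2 * #|S| * cls] and [#|S| <= 2 * #|D|] gives
   [s <= 16 * #|D| * cls]; then [n <= E * s] and [m * cls <= 2 * n] produce the factor 32. *)
have mD : m <= 32 * E * #|D|.
  have sD : s <= 16 * #|D| * cls by have := leq_mul cS (leqnn cls); lia.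
  have h1 : m * n <= m * (E * (16 * #|D| * cls)).
    by rewrite leq_mul2l (leq_trans nE) ?orbT // leq_mul2l sD orbT.
  have h2 := leq_mul mcls (leqnn (E * (16 * #|D|))).
  rewrite -(leq_pmul2r n0); lia.
have [||||i [j [iD jD h1 h2]]] := @hB _ D (fun i => f (v i)) (fun i => f (u i)).
- by move=> i j iD jD; have [_ + _] := Dp i j iD jD.
- by move=> i j iD jD; have [+ _ _] := Dp i j iD jD.
- by move=> i j iD jD; rewrite eq_sym; have [_ _ +] := Dp j i jD iD.
- exact: mD.
exists i, j; split=> //.
  by have := subsetP DF _ iD; rewrite inE => /andP [].
by have := subsetP DF _ jD; rewrite inE => /andP [].
Qed.

(* Halving the set of the types involved gives a pairing in [B], hence an edge, and in a
   triangle-free graph adjacent vertices have no common neighbour. *)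
Lemma heavy_pair_diagonal :
  s <= 4 * #|[set i | (h <= #|cell i|) && (f (u i) == f (v i))]| -> exists i j, heavy_pair i j.
Proof.
set F := [set i | _] => hF.
pose A := [set f (u i) | i in F].
have cF : #|F| <= #|A| * cls.
  apply: leq_trans (card_meet A ui).
  by apply/subset_leq_card/subsetP => i iF; rewrite inE imset_f.
have mA : m <= 8 * E * #|A|.
  have h1 : m * n <= m * (E * (4 * #|A| * cls)).
    by rewrite leq_mul2l (leq_trans nE) ?orbT // leq_mul2l; apply/orP; right; lia.
  have h2 := leq_mul mcls (leqnn (E * (4 * #|A|))).
  rewrite -(leq_pmul2r n0); lia.
have [a0 _] : exists a, a \in A by apply/card_gt0P; move: mA mE; case: #|A|; lia.
pose r := #|A| %/ 2.
have r2 : r + r <= #|A| by rewrite /r; lia.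
(* Since [8 * E < m], the set [A] has at least two elements, so its rounded half [r] is at least
   [#|A| / 4], and [8 * E] becomes [32 * E]. *)
have mr : m <= 32 * E * #|[set: 'I_r]|.
  rewrite cardsT card_ord.
  have A2 : 1 < #|A| by rewrite ltnNge; apply/negP => A1; have := leq_mul (leqnn (8 * E)) A1; lia.
  have A3 : #|A| <= 4 * r by rewrite /r; lia.
  have := leq_mul (leqnn (8 * E)) A3; lia.
pose x (i : 'I_r) := nth a0 (enum A) i.
pose y (i : 'I_r) := nth a0 (enum A) (r + i).
have sA : size (enum A) = #|A| by rewrite -cardE.
have l1 (i : 'I_r) : i < size (enum A) by rewrite sA; have := ltn_ord i; lia.
have l2 (i : 'I_r) : r + i < size (enum A) by rewrite sA; have := ltn_ord i; lia.
have [||||i [j [_ _ h1 _]]] := @hB _ [set: 'I_r] x y.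
- by move=> i j _ _ /eqP; rewrite nth_uniq ?enum_uniq // => /eqP /val_inj.
- by move=> i j _ _ /eqP; rewrite nth_uniq ?enum_uniq // eqn_add2l => /eqP /val_inj.
- by move=> i j _ _; rewrite nth_uniq ?enum_uniq //; have := ltn_ord i; lia.
- exact: mr.
have yA (k : 'I_r) : y k \in A by rewrite -mem_enum mem_nth.
have /imsetP [p pF ep] := yA i; have /imsetP [q qF eq] := yA j.
move: pF qF; rewrite !inE => /andP [p1 /eqP p2] /andP [q1 /eqP q2].
rewrite ep eq in h1; exists p, q; split=> //; rewrite -p2 -q2.
apply/existsP => -[z /andP [z1 z2]]; exact: tB h1 z2 z1.
Qed.

(** Light indices make up at most a quarter of all, so the heavy off-diagonal or the heavy diagonal
    ones make up at least a quarter. *)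
Lemma exists_heavy_pair : exists i j, heavy_pair i j.
Proof.
set F := [set i | (h <= #|cell i|) && (f (u i) != f (v i))].
set F' := [set i | (h <= #|cell i|) && (f (u i) == f (v i))].
have cs : s <= m * m * h + #|F| + #|F'|.
  rewrite -[s in s <= _]card_ord -cardsT.
  apply: (@leq_trans #|[set i | #|cell i| < h] :|: F :|: F'|).
    apply/subset_leq_card/subsetP => i _; rewrite !inE.
    by case: (ltnP #|cell i| h) => //= _; case: eqP.
  apply: leq_trans (leq_card_setU _ _).1 _; rewrite leq_add2r.
  apply: leq_trans (leq_card_setU _ _).1 _; rewrite leq_add2r; exact: card_light.
have hs : 4 * (m * m) * h <= s.
  have E0 : 0 < E by move: nE n0; case: E => //; lia.
  by rewrite -(leq_pmul2r E0) (leq_trans hh) // mulnC.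
case: (leqP s (4 * #|F|)) => [/heavy_pair_off_diagonal //|h1].
apply: heavy_pair_diagonal; rewrite -/F'; lia.
Qed.
End HeavyCells.

(** * The two-layer graph *)

Lemma card_residue_class (n m : nat) (m0 : 0 < m) (a : 'I_m) :
  #|[set x : 'I_n | Ordinal (ltn_pmod x m0) == a]| <= (n %/ m).+1.
Proof.
set C := [set x | _].
have lt (x : 'I_n) : x %/ m < (n %/ m).+1 by rewrite ltnS leq_div2r // ltnW.
pose q x := Ordinal (lt x).
have qi : {in C &, injective q}.
  move=> x y; rewrite !inE => /eqP /(congr1 val) /= xa /eqP /(congr1 val) /= ya [e].
  by apply: val_inj; rewrite /= (divn_eq x m) (divn_eq y m) xa ya e.
by rewrite -(card_in_imset qi) -[X in _ <= X]card_ord max_card.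
Qed.

Lemma exists_triangle_free_no_pairing (E : nat) : 0 < E -> exists N, forall n, N <= n ->
  exists H : rel 'I_n, [/\ simple_graph H, triangle_free H &
    forall (s : nat) (u v : 'I_s -> 'I_n), injective u -> injective v ->
      (forall i j, u i != v j) -> n <= E * s ->
      exists i j, [/\ i != j, H (u i) (u j) & H (v i) (v j)]].
Proof.
move=> E0; have [|N1 hN1] := @exists_host (32 * E); first by rewrite muln_gt0.
pose m := N1 + (8 * E).+1.
have [|B [[iB sB] tB hB]] := hN1 m; first exact: leq_addr.
have m0 : 0 < m by rewrite /m; lia.
have mE : 8 * E < m by rewrite /m; lia.
clearbody m.
(* Cells will be heavy from size [n %/ d] on, as [hh] demands. This is at least [n / (2 * d)], so
   two heavy cells give [n ^ 2 / (2 * d) ^ 2] index pairs: hence the parameter [(2 * d) ^ 2]. *)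
pose d := 4 * (m * m) * E.
have d0 : 0 < d by rewrite !muln_gt0 m0 E0.
have [|N2 hN2] := @pseudorandom_triangle_free ((2 * d) ^ 2); first by rewrite expn_gt0 muln_gt0 d0.
exists (N2 + m + d) => n hn.
have n2 : N2 <= n by move: hn; clear; lia.
have mn : m <= n by move: hn; clear; lia.
have dn : d <= n by move: hn; clear; lia.
have n0 : 0 < n by apply: leq_trans mn.
pose f (x : 'I_n) := Ordinal (ltn_pmod x m0).
have [R [[iR sR] tR hR]] := hN2 n n2
  (fun x y x' y' => B (f x) (f y) && ~~ common_nbr B (f x') (f y')).
exists (fun x y => (B (f x) (f y) && ~~ common_nbr R x y)
                || (R x y && ~~ common_nbr B (f x) (f y))).
have cs (T : finType) (e : rel T) x y : common_nbr e x y = common_nbr e y x.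
  by apply: eq_existsb => z; rewrite andbC.
have nc (T : finType) (e : rel T) x y z : ~~ common_nbr e x y -> e x z -> e y z -> False.
  by move=> /existsP h xz yz; apply: h; exists z; rewrite xz yz.
split.
- split=> [x|x y]; first by rewrite iB iR.
  by rewrite sB sR (cs _ R) (cs _ B).
(* A triangle within one layer contradicts [tB] or [tR]. Otherwise two edges lie in one layer, and
   their shared vertex gives the ends of the third edge a common neighbour that the other layer
   forbids. *)
- move=> x y z /orP [/andP [xy nxy]|/andP [xy nxy]] /orP [/andP [yz nyz]|/andP [yz nyz]]
    /orP [/andP [xz nxz]|/andP [xz nxz]].
  + exact: tB xy yz xz.
  + by apply: nc nxz xy _; rewrite sB.
  + by apply: nc nyz _ _; [rewrite sB; exact: xy|rewrite sB].
  + by apply: nc nxy xz yz.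
  + by apply: nc nxy xz yz.
  + by apply: nc nyz _ _; [rewrite sR; exact: xy|rewrite sR].
  + by apply: nc nxz xy _; rewrite sR.
  + exact: tR xy yz xz.
move=> s u v ui vi uv nE.
pose h := n %/ d.
have hh : 4 * (m * m) * h * E <= n by rewrite mulnAC mulnC leq_trunc_div.
have mcls : m * (n %/ m).+1 <= 2 * n.
  by rewrite mulnS mul2n -addnn leq_add // mulnC leq_trunc_div.
have [i [j [hi hj hb hc]]] := exists_heavy_pair hB tB (@card_residue_class n m m0) mcls mE n0 hh nE ui vi.
have [|||| i' [j' [_ _ /andP [hB' hc'] r nr]]] := hR _ [set: 'I_s] u v.
- by move=> x y _ _; exact: ui.
- by move=> x y _ _; exact: vi.
- by move=> x y _ _; exact: uv.
- apply: (@leq_trans ((2 * d) ^ 2 * (h * h))).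
    rewrite -mulnn -!expnMn mulnn; rewrite leq_exp2r //.
    by apply: leq_double_divn; rewrite d0 dn.
  rewrite leq_mul2l; apply/orP; right.
  apply: leq_trans (leq_mul hi hj) _; rewrite -cardsX.
  apply/subset_leq_card/subsetP => -[x y]; rewrite !inE /=.
  by move=> /andP [/andP [/eqP e1 /eqP e2] /andP [/eqP e3 /eqP e4]]; rewrite /f e1 e2 e3 e4 hb hc.
(* The [u]-pair is an edge of the first layer, the [v]-pair one of the second. *)
exists i', j'; split.
- by apply/eqP => e; rewrite e iR in r.
- by rewrite hB' nr.
- by rewrite r hc' orbT.
Qed.

(** * Passing to the complement *)

Lemma alpha_le_compl (T : finType) (H : rel T) :
  triangle_free H -> alpha_le (fun x y => (x != y) && ~~ H x y) 2.
Proof.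
move=> tH A indA; rewrite leqNgt; apply/negP => A3.
have /card_gt2P [x [y [z [[xA yA zA] [xy yz zx]]]]] := A3.
have a p q : p \in A -> q \in A -> p != q -> H p q.
  by move=> pA qA pq; have := indA p q pA qA; rewrite pq negbK.
apply: (tH x y z); apply: a => //; by rewrite eq_sym.
Qed.

Local Open Scope ring_scope.

Theorem theorem3p1 (R : realType) (eps : R) (heps : 0 < eps) :
  exists N : nat, forall n : nat, (N <= n)%N ->
    exists e : rel 'I_n,
      simple_graph e /\ alpha_le e 2 /\
      forall (s : nat) (u v : 'I_s -> 'I_n),
        odd_connected_pairing e u v -> s%:R < eps * n%:R.
Proof.
(* Since [E.+1] exceeds [1 / eps], a pairing of size [s >= eps * n] satisfies [n <= E.+1 * s]. *)
have [E E1] : exists E : nat, eps^-1 < E.+1%:R.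
  exists (Num.bound eps^-1); apply: lt_trans (archi_boundP _) _; last by rewrite ltr_nat.
  by rewrite invr_ge0 ltW.
have [N hN] := @exists_triangle_free_no_pairing E.+1 isT.
exists N => n /hN [H [[iH sH] tH hH]].
exists (fun x y => (x != y) && ~~ H x y); split.
  by split=> [x|x y]; [rewrite eqxx | rewrite eq_sym sH].
split; first exact: alpha_le_compl.
move=> s u v [ui [vi [uv hp]]]; rewrite ltNge; apply/negP => hs.
have nE : (n <= E.+1 * s)%N.
  rewrite -(ler_nat R) natrM.
  have h1 : n%:R <= eps^-1 * s%:R :> R by rewrite ler_pdivlMl.
  by apply: le_trans h1 _; rewrite ler_wpM2r ?ler0n // ltW.
have [i [j [ij h1 h2]]] := hH s u v ui vi uv nE.
by have := hp i j ij; rewrite h1 h2 !andbF; case.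
Qed.
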